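(* Let $T_\psi(n)$ be as defined in the context and let $\psi(q)=\sum_{n\ge1}\frac{q^{n^2}}{(q;q^2)_n}$. Then, as formal power series (equivalently for $|q|<1$), $$\sum_{n\ge1}T_\psi(n)q^n=\psi(q).$$
   Context: $(a;q)_n=\prod_{j=0}^{n-1}(1-aq^j)$, $(a;q)_\infty=\prod_{j\ge0}(1-aq^j)$. A two-color partition is a partition whose parts are each colored blue or green (the same integer may occur in both colors). $T_\psi(n)$ is the signed count of two-color partitions of $n$ such that: all even parts are blue and the even parts are distinct; the blue odd parts are distinct; the smallest part is odd and blue; (all green parts are odd and may repeat). Each such partition is counted with weight $(-1)^j$, where $j$ is the number of even parts. Equivalently, $\sum_{n\ge1}T_\psi(n)q^n=\sum_{n\ge0}\frac{q^{2n+1}(-q^{2n+3};q^2)_\infty(q^{2n+2};q^2)_\infty}{(q^{2n+1};q^2)_\infty}$. *)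

(* Defs.v *)
From HB Require Import structures.
From mathcomp Require Import all_boot all_order all_algebra.
From mathcomp Require Import boolp classical_sets.

Set Implicit Arguments.
Unset Strict Implicit.
Unset Printing Implicit Defensive.

Import GRing.Theory.
Local Open Scope ring_scope.

(* A formal power series f is applied to n to get its n-th coefficient. *)
Record fps (R : Type) := FPS { fps_coef :> nat -> R }.

Reserved Notation "{ 'fps' R }" (at level 0, format "{ 'fps'  R }").
Notation "{ 'fps' R }" := (fps R) : type_scope.

Lemma fpsP (R : Type) (f g : {fps R}) :
  (forall n, f n = g n) <-> f = g.
Proof.
by split=> [|-> //]; case: f g => [f] [g] /= fg; congr FPS; apply/funext.
Qed.

HB.instance Definition _ (R : Type) := gen_eqMixin {fps R}.
HB.instance Definition _ (R : Type) := gen_choiceMixin {fps R}.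

Section Zmodule.
Variable R : zmodType.
Implicit Types f g h : {fps R}.

Definition fps_zero : {fps R} := FPS (fun=> 0).
Definition fps_add f g : {fps R} := FPS (fun n => f n + g n).
Definition fps_opp f : {fps R} := FPS (fun n => - f n).

Let addA : associative fps_add.
Proof. by move=> f g h; apply/fpsP => n /=; rewrite addrA. Qed.
Let addC : commutative fps_add.
Proof. by move=> f g; apply/fpsP => n /=; rewrite addrC. Qed.
Let add0 : left_id fps_zero fps_add.
Proof. by move=> f; apply/fpsP => n /=; rewrite add0r. Qed.
Let addN : left_inverse fps_zero fps_opp fps_add.
Proof. by move=> f; apply/fpsP => n /=; rewrite addNr. Qed.

HB.instance Definition _ :=
  GRing.isZmodule.Build {fps R} addA addC add0 addN.

Lemma coef_fps0 n : (0 : {fps R}) n = 0. Proof. by []. Qed.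
Lemma coef_fpsD f g n : (f + g) n = f n + g n. Proof. by []. Qed.
Lemma coef_fpsN f n : (- f) n = - f n. Proof. by []. Qed.
Lemma coef_fpsB f g n : (f - g) n = f n - g n. Proof. by []. Qed.

Lemma coef_fps_sum I (r : seq I) (P : pred I) (F : I -> {fps R}) n :
  (\sum_(i <- r | P i) F i) n = \sum_(i <- r | P i) (F i) n.
Proof. by apply: (big_morph (fun f : {fps R} => f n)). Qed.

End Zmodule.

Section Ring.
Variable R : comNzRingType.
Implicit Types f g h : {fps R}.

Definition fps_one : {fps R} := FPS (fun n => (n == 0%N)%:R).
Definition fps_mul f g : {fps R} :=
  FPS (fun n => \sum_(i < n.+1) f i * g (n - i)%N).

Let trunc N f : {poly R} := \poly_(i < N.+1) f i.

Let mul_trunc N n f g : (n <= N)%N ->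
  (fps_mul f g) n = (trunc N f * trunc N g)`_n.
Proof.
move=> nN; rewrite coefM; apply: eq_bigr => i _; rewrite !coef_poly !ltnS.
have iN : (i <= N)%N by apply: leq_trans nN; rewrite -ltnS.
by rewrite iN (leq_trans (leq_subr _ _) nN).
Qed.

Let mulA : associative fps_mul.
Proof.
move=> f g h; apply/fpsP => n.
transitivity ((trunc n f * (trunc n g * trunc n h))`_n).
  rewrite coefM; apply: eq_bigr => i _.
  by rewrite coef_poly ltn_ord -(mul_trunc _ _ (leq_subr _ _)).
rewrite mulrA coefM; apply: eq_bigr => i _.
rewrite coef_poly ltnS leq_subr -mul_trunc //.
by rewrite -ltnS ltn_ord.
Qed.
Let mulC : commutative fps_mul.
Proof.
by move=> f g; apply/fpsP => n; rewrite !(mul_trunc _ _ (leqnn n)) mulrC.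
Qed.
Let mul1 : left_id fps_one fps_mul.
Proof.
move=> f; apply/fpsP => n /=; rewrite big_ord_recl /= mul1r subn0.
by rewrite big1 ?addr0 // => i _; rewrite mul0r.
Qed.
Let mulDl : left_distributive fps_mul +%R.
Proof.
move=> f g h; apply/fpsP => n /=; rewrite -big_split /=.
by apply: eq_bigr => i _; rewrite -mulrDl.
Qed.
Let one_neq0 : fps_one != 0.
Proof.
apply/eqP => /fpsP/(_ 0%N) /= /eqP.
by rewrite oner_eq0.
Qed.

HB.instance Definition _ :=
  GRing.Zmodule_isComNzRing.Build {fps R} mulA mulC mul1 mulDl one_neq0.

Lemma coef_fps1 n : (1 : {fps R}) n = (n == 0%N)%:R. Proof. by []. Qed.
Lemma coef_fpsM f g n :
  (f * g) n = \sum_(i < n.+1) f i * g (n - i)%N.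
Proof. by []. Qed.

Definition fps_scale (c : R) f : {fps R} := FPS (fun n => c * f n).

Let scaleA a b f : fps_scale a (fps_scale b f) = fps_scale (a * b) f.
Proof. by apply/fpsP => n /=; rewrite mulrA. Qed.
Let scale1 : left_id 1 fps_scale.
Proof. by move=> f; apply/fpsP => n /=; rewrite mul1r. Qed.
Let scaleDr : right_distributive fps_scale +%R.
Proof. by move=> a f g; apply/fpsP => n /=; rewrite mulrDr. Qed.
Let scaleDl f : {morph fps_scale^~ f : a b / a + b}.
Proof. by move=> a b; apply/fpsP => n /=; rewrite mulrDl. Qed.

HB.instance Definition _ :=
  GRing.Zmodule_isLmodule.Build R {fps R} scaleA scale1 scaleDr scaleDl.

Lemma coef_fpsZ c f n : (c *: f) n = c * f n. Proof. by []. Qed.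

Definition fpsX : {fps R} := FPS (fun n => (n == 1%N)%:R).

Lemma coef_fpsXn k n : (fpsX ^+ k) n = (n == k)%:R.
Proof.
elim: k n => [|k IHk] n; first by rewrite expr0 coef_fps1.
rewrite exprS coef_fpsM; case: n => [|n].
  by rewrite big_ord1 /= mul0r.
rewrite big_ord_recl big_ord_recl /= mul0r add0r mul1r.
rewrite big1 ?addr0 => [|i _]; last by rewrite mul0r.
by rewrite IHk /bump subn1 eqSS.
Qed.

End Ring.

Arguments fpsX {R}.

Section Unit.
Variable R : comUnitRingType.
Implicit Types f g : {fps R}.

(* The coefficients of the inverse of f, computed from f * f^-1 = 1. *)
Fixpoint fps_inv_seq f n : seq R :=
  if n is n'.+1 then
    let s := fps_inv_seq f n' in
    rcons s (- (f 0%N)^-1 * \sum_(i < n'.+1) f (n'.+1 - i)%N * s`_i)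
  else [:: (f 0%N)^-1].

Definition fps_unit : {pred {fps R}} := fun f => f 0%N \is a GRing.unit.
Definition fps_inv f : {fps R} :=
  if fps_unit f then FPS (fun n => (fps_inv_seq f n)`_n) else f.

Let size_inv_seq f n : size (fps_inv_seq f n) = n.+1.
Proof. by elim: n => //= n IHn; rewrite size_rcons IHn. Qed.

Let nth_inv_seq f n i :
  (i <= n)%N -> (fps_inv_seq f n)`_i = (fps_inv_seq f i)`_i.
Proof.
elim: n => [|n IHn]; first by rewrite leqn0 => /eqP ->.
rewrite leq_eqVlt ltnS => /orP[/eqP -> //|le_in].
by rewrite /= nth_rcons size_inv_seq ltnS le_in IHn.
Qed.

Let mulV : {in fps_unit, left_inverse 1 fps_inv *%R}.
Proof.
move=> f Uf; rewrite /fps_inv; have -> : fps_unit f by [].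
apply/fpsP => -[|n]; rewrite coef_fpsM coef_fps1.
  by rewrite big_ord1 /= mulVr.
rewrite big_ord_recr /= nth_rcons size_inv_seq ltnn eqxx subnn.
rewrite mulrAC mulNr mulVr // mulN1r.
apply/eqP; rewrite subr_eq0; apply/eqP/eq_bigr => i _.
have le_in : (i <= n)%N := ltn_ord i.
by rewrite [in RHS]mulrC (nth_inv_seq _ le_in).
Qed.

Let unitPl f g : g * f = 1 -> fps_unit f.
Proof.
move=> /fpsP/(_ 0%N); rewrite coef_fpsM big_ord1 coef_fps1 /= => gf1.
by apply/unitrPr; exists (g 0%N); rewrite mulrC.
Qed.

Let inv_out : {in [predC fps_unit], fps_inv =1 id}.
Proof.
by move=> f; rewrite inE /= /fps_inv => /negbTE; rewrite /in_mem /= => ->.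
Qed.

HB.instance Definition _ :=
  GRing.ComNzRing_hasMulInverse.Build {fps R} mulV unitPl inv_out.

Lemma fps_unitE f : (f \is a GRing.unit) = (f 0%N \is a GRing.unit).
Proof. by []. Qed.

End Unit.

Section InfiniteSum.
Variable R : zmodType.
Implicit Types (u : nat -> {fps R}) (s : {fps R}).

Definition fps_cvg u s : Prop :=
  forall k, exists N, forall n, (N <= n)%N -> (u n) k = s k.

Lemma fps_cvg_unique u s t : fps_cvg u s -> fps_cvg u t -> s = t.
Proof.
move=> us ut; apply/fpsP => k.
have [N hN] := us k; have [M hM] := ut k.
by rewrite -(hN (maxn N M)) ?leq_maxl // hM ?leq_maxr.
Qed.

(* The limit of u for coefficientwise stabilisation; 0 if u diverges. *)
Definition fps_lim u : {fps R} := xget 0 [set s | fps_cvg u s].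

Lemma fps_cvg_lim u s : fps_cvg u s -> fps_lim u = s.
Proof.
move=> us; rewrite /fps_lim; case: xgetP => [t _ ut|/(_ s)/(_ us)//].
exact: fps_cvg_unique ut us.
Qed.

Definition fps_series (m : nat) u : {fps R} :=
  fps_lim (fun n => \sum_(m <= i < n) u i).

Lemma fps_cvg_series m u : (forall i k, (k < i)%N -> (u i) k = 0) ->
  fps_cvg (fun n => \sum_(m <= i < n) u i) (fps_series m u).
Proof.
move=> u0.
suff cv : fps_cvg (fun n => \sum_(m <= i < n) u i)
    (FPS (fun k => (\sum_(m <= i < k.+1) u i) k)).
  by rewrite /fps_series (fps_cvg_lim cv).
move=> k; exists (maxn m k.+1) => n; rewrite geq_max => /andP[mn kn] /=.
rewrite !coef_fps_sum; have [mk|km] := leqP m k.+1.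
  rewrite (big_cat_nat mk kn) /= [X in _ + X]big1_seq ?addr0 // => i /=.
  by rewrite mem_index_iota => /andP[ki _]; apply: u0.
rewrite [RHS]big_geq ?(ltnW km) // big1_seq // => i /=.
rewrite mem_index_iota => /andP[mi _]; apply: u0.
by apply: leq_trans mi; apply: ltnW.
Qed.

End InfiniteSum.

Reserved Notation "\sum_ ( m <= i '<oo' ) F"
  (F at level 41,
   format "'[' \sum_ ( m  <=  i  <oo ) '/  '  F ']'").
Notation "\sum_ ( m <= i <oo ) F" := (fps_series m (fun i => F%R)) : ring_scope.

Definition qpoch (A : comNzRingType) (a q : A) (n : nat) : A :=
  \prod_(j < n) (1 - a * q ^+ j).

Definition color := bool.
Definition blue : color := true.
Definition green : color := false.

(* A two-color partition of n is encoded by the multiplicities m (i, c) of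
   its parts of size i.+1 and color c; in a partition of n, part sizes and
   multiplicities are at most n. *)
Definition mults (n : nat) := {ffun 'I_n * color -> 'I_n.+1}.

Definition part_size n (p : 'I_n * color) : nat := p.1.+1.

Definition two_color_partition n (m : mults n) : bool :=
  (\sum_p m p * part_size p == n)%N.

Definition even_parts_blue n (m : mults n) : bool :=
  [forall p, (0 < m p)%N && ~~ odd (part_size p) ==> (p.2 == blue)].

Definition even_parts_distinct n (m : mults n) : bool :=
  [forall p, ~~ odd (part_size p) ==> (m p <= 1)%N].

Definition blue_odd_parts_distinct n (m : mults n) : bool :=
  [forall p, odd (part_size p) && (p.2 == blue) ==> (m p <= 1)%N].

(* A green part may have the same size as the smallest blue part. *)
Definition smallest_part_odd_blue n (m : mults n) : bool :=
  [exists p, [&& (0 < m p)%N, odd (part_size p), p.2 == blue &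
    [forall r, (0 < m r)%N ==> (part_size p <= part_size r)%N]]].

Definition nb_even_parts n (m : mults n) : nat :=
  (\sum_(p | ~~ odd (part_size p)) m p)%N.

Definition Tpsi (n : nat) : int :=
  \sum_(m : mults n | [&& two_color_partition m, even_parts_blue m,
      even_parts_distinct m, blue_odd_parts_distinct m &
      smallest_part_odd_blue m])
    (-1) ^+ nb_even_parts m.

Definition psi_term (n : nat) : {fps int} :=
  fpsX ^+ (n ^ 2) / qpoch fpsX (fpsX ^+ 2) n.

Definition psi : {fps int} := \sum_(1 <= n <oo) psi_term n.

Lemma qpoch_unit n :
  qpoch (fpsX : {fps int}) (fpsX ^+ 2) n \is a GRing.unit.
Proof.
rewrite unitr_prod // => j.
rewrite fps_unitE coef_fpsB coef_fps1 coef_fpsM big_ord1 mul0r subr0.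
by rewrite unitr1.
Qed.

Lemma psi_cvg : fps_cvg (fun n => \sum_(1 <= i < n) psi_term i) psi.
Proof.
apply: fps_cvg_series => i k ki; rewrite /psi_term coef_fpsM big1 // => j _.
rewrite coef_fpsXn; case: eqP => [ji|]; last by rewrite mul0r.
have := ltn_ord j; rewrite ji ltnS => /leq_ltn_trans/(_ ki).
by rewrite ltnNge; case: (i) => // i'; rewrite leq_pmulr.
Qed.

Lemma Tpsi_series_cvg :
  fps_cvg (fun n => \sum_(1 <= i < n) Tpsi i *: fpsX ^+ i)
    (\sum_(1 <= n <oo) Tpsi n *: fpsX ^+ n).
Proof.
apply: fps_cvg_series => i k ki.
by rewrite coef_fpsZ coef_fpsXn ltn_eqF // mulr0.
Qed.

(* Main.v *)
Require Import Defs.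
From mathcomp Require Import all_boot all_order all_algebra.
From mathcomp Require Import ring zify.
Import GRing.Theory.
Local Open Scope ring_scope.

Set Implicit Arguments.
Unset Strict Implicit.
Unset Printing Implicit Defensive.

(* With Q = q^2, put
     L_k = sum_t Q^t prod_(j >= t) (1 - Q^(j+1)) (1 + q^(2j+2k+3)) / (1 - q^(2j+1)),
   so that q L_0 is the generating function of T_psi, t indexing the smallest
   part 2t+1.  If E_t is the t-th product, then the differences of
   (1 - Q^t) E_t, which goes from 0 to 1, give
     L_k = 1 + q (1 + q^(2k+2)) L_(k+1).
   Writing psi_n for the n-th term of psi, V_k = sum_(j >= 0) Q^(k j) psi_(j+1)
   satisfies V_k = q + q (1 + q^(2k+2)) V_(k+1), again by telescoping, and
   V_0 = psi.  Iterating the difference gives q L_0 = V_0.  Infinite products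
   are avoided by working modulo powers of q. *)

Local Notation q := (fpsX : {fps int}).

(** * Congruence of power series modulo a power of [q] *)

Definition eqm (N : nat) (f g : {fps int}) := forall k, (k < N)%N -> f k = g k.

Section Eqm.
Variable N : nat.
Implicit Types f g h u : {fps int}.

Lemma eqm_refl f : eqm N f f. Proof. by []. Qed.

Lemma eqm_eq f g : f = g -> eqm N f g. Proof. by move=> ->. Qed.

Lemma eqm_sym f g : eqm N f g -> eqm N g f.
Proof. by move=> fg k kN; rewrite fg. Qed.

Lemma eqm_trans f g h : eqm N f g -> eqm N g h -> eqm N f h.
Proof. by move=> fg gh k kN; rewrite fg ?gh. Qed.

Lemma eqmD f f' g g' : eqm N f f' -> eqm N g g' -> eqm N (f + g) (f' + g').
Proof. by move=> ff gg k kN; rewrite !coef_fpsD ff ?gg. Qed.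

Lemma eqmM f f' g g' : eqm N f f' -> eqm N g g' -> eqm N (f * g) (f' * g').
Proof.
move=> ff gg k kN; rewrite !coef_fpsM; apply: eq_bigr => -[i /= ik] _.
by rewrite ff ?gg //; lia.
Qed.

Lemma eqmN f g : eqm N f g -> eqm N (- f) (- g).
Proof. by move=> fg k kN; rewrite !coef_fpsN fg. Qed.

Lemma eqmB f f' g g' : eqm N f f' -> eqm N g g' -> eqm N (f - g) (f' - g').
Proof. by move=> ff gg; apply: eqmD => //; apply: eqmN. Qed.

Lemma eqm_subr0 f g : eqm N (f - g) 0 -> eqm N f g.
Proof.
by move=> fg k kN; apply/eqP; rewrite -subr_eq0 -coef_fpsB fg.
Qed.

Lemma eqm_sum (I : eqType) (r : seq I) (P : pred I) (F G : I -> {fps int}) :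
  (forall i, i \in r -> P i -> eqm N (F i) (G i)) ->
  eqm N (\sum_(i <- r | P i) F i) (\sum_(i <- r | P i) G i).
Proof.
move=> FG; rewrite big_seq_cond [X in eqm _ _ X]big_seq_cond.
by elim/big_ind2: _ => [//|? ? ? ?|i /andP[]]; [apply: eqmD|apply: FG].
Qed.

Lemma eqm_prod (I : eqType) (r : seq I) (P : pred I) (F G : I -> {fps int}) :
  (forall i, i \in r -> P i -> eqm N (F i) (G i)) ->
  eqm N (\prod_(i <- r | P i) F i) (\prod_(i <- r | P i) G i).
Proof.
move=> FG; rewrite big_seq_cond [X in eqm _ _ X]big_seq_cond.
by elim/big_ind2: _ => [//|? ? ? ?|i /andP[]]; [apply: eqmM|apply: FG].
Qed.

Lemma eqm_mulI u f g : u \is a GRing.unit -> eqm N (u * f) (u * g) -> eqm N f g.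
Proof.
by move=> Uu /(eqmM (eqm_refl u^-1)); rewrite !mulKr.
Qed.

Lemma eqmX m : (N <= m)%N -> eqm N (q ^+ m) 0.
Proof. by move=> Nm k kN; rewrite coef_fpsXn coef_fps0; case: eqP => //; lia. Qed.

Lemma eqm_mulX m f : (N <= m)%N -> eqm N (q ^+ m * f) 0.
Proof. by move=> Nm; rewrite -(mul0r f); apply: eqmM => //; apply: eqmX. Qed.

Lemma eqm1DX m : (N <= m)%N -> eqm N (1 + q ^+ m) 1.
Proof.
by move=> Nm; rewrite -[X in eqm _ _ X]addr0; apply: eqmD => //; apply: eqmX.
Qed.

Lemma eqm1BX m : (N <= m)%N -> eqm N (1 - q ^+ m) 1.
Proof.
by move=> Nm; rewrite -[X in eqm _ _ X]subr0; apply: eqmB => //; apply: eqmX.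
Qed.

End Eqm.

Arguments eqm_refl {N} f.

Lemma unit1BX m : 1 - q ^+ m.+1 \is a GRing.unit.
Proof. by rewrite fps_unitE coef_fpsB coef_fps1 coef_fpsXn subr0. Qed.

Lemma unit1DX m : 1 + q ^+ m.+1 \is a GRing.unit.
Proof. by rewrite fps_unitE coef_fpsD coef_fps1 coef_fpsXn addr0. Qed.

(** * The recursions for [Lsum] and [Vsum], and their comparison *)

Section Telescope.
(* Truncation order: all factors with j >= N are trivial modulo q ^+ N. *)
Variable N : nat.

(** The parameter [k] moves only the factors of the blue odd parts; at [k = 0] these are the sizes
    beyond the smallest part [2t+1]. *)
Definition Eterm (k t : nat) : {fps int} :=
  \prod_(t <= j < N) ((1 - q ^+ (2 * j).+2) * (1 + q ^+ (2 * (j + k)).+3)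
                      / (1 - q ^+ (2 * j).+1)).

Definition Lsum (k : nat) : {fps int} :=
  \sum_(0 <= t < N) q ^+ (2 * t) * Eterm k t.

Lemma Eterm_rec k t : (t < N)%N ->
  (1 - q ^+ (2 * t).+1) * Eterm k t =
  (1 - q ^+ (2 * t).+2) * (1 + q ^+ (2 * (t + k)).+3) * Eterm k t.+1.
Proof.
move=> tN; rewrite /Eterm big_ltn // !mulrA; congr (_ * _).
by rewrite mulrC -!mulrA mulKr ?unit1BX.
Qed.

Lemma Eterm_split k t : Eterm k t =
  (\prod_(t <= j < N) ((1 - q ^+ (2 * j).+2) / (1 - q ^+ (2 * j).+1)))
  * \prod_(t <= j < N) (1 + q ^+ (2 * (j + k)).+3).
Proof. by rewrite -big_split; apply: eq_bigr => j _; rewrite mulrAC. Qed.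

(** Raising [k] shifts the index of the blue odd factors by one, so the two sides differ exactly by
    the factor at index [N], which is 1 modulo [q ^+ N]. *)
Lemma Eterm_shift k t : (t <= N)%N ->
  eqm N (Eterm k t) ((1 + q ^+ (2 * (t + k)).+3) * Eterm k.+1 t).
Proof.
move=> tN.
suff -> : (1 + q ^+ (2 * (t + k)).+3) * Eterm k.+1 t =
   (1 + q ^+ (2 * (N + k)).+3) * Eterm k t.
  by rewrite -{1}[Eterm k t]mul1r; apply: eqmM => //; apply/eqm_sym/eqm1DX; lia.
pose h i : {fps int} := 1 + q ^+ (2 * (i + k)).+3.
have H : h t * \prod_(t <= i < N) (1 + q ^+ (2 * (i + k.+1)).+3) =
    h N * \prod_(t <= i < N) h i.
  have -> : h N * \prod_(t <= i < N) h i = h t * \prod_(t.+1 <= i < N.+1) h i.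
    by rewrite -big_ltn // mulrC -big_nat_recr.
  suff -> : \prod_(t <= i < N) (1 + q ^+ (2 * (i + k.+1)).+3) =
    \prod_(t.+1 <= i < N.+1) h i by [].
  rewrite [RHS]big_add1; apply: eq_bigr => i _; congr (1 + q ^+ _); lia.
by rewrite !Eterm_split mulrCA [X in _ * X]H mulrCA.
Qed.

Lemma Lsum_rec k : eqm N (Lsum k) (1 + q * (1 + q ^+ (2 * k).+2) * Lsum k.+1).
Proof.
pose v t := (1 - q ^+ (2 * t)) * Eterm k t.
have step t : (t < N)%N -> eqm N (v t.+1 - v t)
    (q ^+ (2 * t) * Eterm k t
     - q * (1 + q ^+ (2 * k).+2) * (q ^+ (2 * t) * Eterm k.+1 t)).
  move=> tN; have sh := Eterm_shift k (ltnW tN).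
  (* Both [v t.+1] and [v t] are brought to multiples of [Eterm k.+1 t], so that only a polynomial
     identity remains for [ring]. *)
  have v1 : eqm N (v t.+1) ((1 - q ^+ (2 * t).+1) * Eterm k.+1 t).
    apply: (@eqm_mulI N (1 + q ^+ (2 * (t + k)).+3)); first exact: unit1DX.
    rewrite /v (_ : (2 * t.+1 = (2 * t).+2)%N); last by lia.
    rewrite [X in eqm _ X]mulrCA [X in eqm _ X]mulrA -(Eterm_rec k tN).
    rewrite [X in eqm _ _ X]mulrCA.
    exact: eqmM (eqm_refl _) sh.
  have v0 : eqm N (v t)
      ((1 - q ^+ (2 * t)) * ((1 + q ^+ (2 * (t + k)).+3) * Eterm k.+1 t)).
    exact: eqmM (eqm_refl _) sh.
  apply: eqm_trans (eqmB v1 v0) _.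
  apply: eqm_trans; last first.
    by apply: eqmB; [apply: eqmM (eqm_refl _) (eqm_sym sh)|exact: eqm_refl].
  rewrite mulnDr !exprS !exprD; apply: eqm_eq.
  ring.
have : eqm N (\sum_(0 <= t < N) (v t.+1 - v t))
    (Lsum k - q * (1 + q ^+ (2 * k).+2) * Lsum k.+1).
  rewrite /Lsum mulr_sumr -sumrB; apply: eqm_sum => t.
  by rewrite mem_index_iota => tN _; exact: step.
(* [v 0] vanishes through [1 - q ^+ 0], and [v N] is [1 - q ^+ (2 * N)] because its product is
   empty. *)
rewrite telescope_sumr // /v /Eterm big_geq // mulr1 expr0 subrr mul0r subr0.
move=> H.
have H1 : eqm N (1 - q ^+ (2 * N)) 1 by apply: eqm1BX; lia.
have := eqmD (eqm_trans (eqm_sym H1) H)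
  (eqm_refl (q * (1 + q ^+ (2 * k).+2) * Lsum k.+1)).
by rewrite subrK => /eqm_sym.
Qed.

Definition Vsum (k : nat) : {fps int} :=
  \sum_(0 <= j < N) q ^+ (2 * k * j) * psi_term j.+1.

(** The exponents differ by [(j+1)^2 - j^2 = 2j+1], and the denominator gains one factor. The case
    [j = 0] uses [psi_term 0 = 1], a term outside [psi]. *)
Lemma psi_term_rec j :
  psi_term j.+1 * (1 - q ^+ (2 * j).+1) = q ^+ (2 * j).+1 * psi_term j.
Proof.
rewrite /psi_term [qpoch _ _ j.+1]/qpoch big_ord_recr /= -/(qpoch q (q ^+ 2) j).
have -> : q * (q ^+ 2) ^+ j = q ^+ (2 * j).+1 by rewrite [RHS]exprS exprM.
rewrite invrM ?qpoch_unit ?unit1BX // [LHS]mulrC mulrCA mulVKr ?unit1BX //.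
by rewrite [RHS]mulrA -exprD; congr (q ^+ _ / _); lia.
Qed.

Lemma Vsum_rec k : eqm N (Vsum k) (q + q * (1 + q ^+ (2 * k).+2) * Vsum k.+1).
Proof.
(* The boundary value [A 0 = q] is the constant term of the recursion, and [A N] is divisible by
   [q ^+ N]. *)
pose A j := q ^+ ((2 * k).+2 * j).+1 * psi_term j.
have E : Vsum k - q * (1 + q ^+ (2 * k).+2) * Vsum k.+1 =
     \sum_(0 <= j < N) (- A j.+1 - - A j).
  rewrite /Vsum mulr_sumr -sumrB; apply: eq_bigr => j _.
  have -> : A j = q ^+ (2 * k * j) * (psi_term j.+1 * (1 - q ^+ (2 * j).+1)).
    by rewrite psi_term_rec mulrA -exprD /A; congr (q ^+ _ * _); lia.
  rewrite /A (_ : (2 * k.+1 * j = 2 * k * j + 2 * j)%N); last by lia.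
  rewrite (_ : ((2 * k).+2 * j.+1 = 2 * k * j + 2 * j + 2 * k + 2)%N); last by lia.
  by rewrite !exprS !exprD; ring.
have : eqm N (Vsum k - q * (1 + q ^+ (2 * k).+2) * Vsum k.+1) q.
  rewrite E telescope_sumr // /A opprK muln0 expr1 addrC.
  rewrite /psi_term expr0 /qpoch big_ord0 divr1 mulr1.
  rewrite -[X in eqm _ _ X]subr0; apply: eqmB => //.
  by apply: eqm_mulX; lia.
move=> /(fun h => eqmD h (eqm_refl (q * (1 + q ^+ (2 * k).+2) * Vsum k.+1))).
by rewrite subrK.
Qed.

Lemma Vsum_psi : eqm N (Vsum 0) psi.
Proof.
have -> : Vsum 0 = \sum_(1 <= i < N.+1) psi_term i.
  by rewrite big_add1 /=; apply: eq_bigr => j _; rewrite mul1r.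
move=> k kN; have [M hM] := psi_cvg k.
(* This partial sum is long enough to have the limit coefficient and to contain [Vsum 0]; its
   further terms are multiples of [q ^+ (i ^ 2)] with [i > k]. *)
rewrite -(hM (M + N.+1)%N) ?leq_addr //.
rewrite [in RHS](@big_cat_nat _ _ _ N.+1); [|lia|lia].
rewrite coef_fpsD -[LHS]addr0; congr (_ + _).
rewrite coef_fps_sum big_nat big1 // => i /andP[Ni _].
by apply: (@eqm_mulX i); nia.
Qed.

(* q * Lsum and Vsum satisfy the same affine recursion, whose homogeneous part
   is divisible by q, so their difference is divisible by every power of q. *)
Lemma Lsum_psi : eqm N (q * Lsum 0) psi.
Proof.
pose D k := q * Lsum k - Vsum k.
have Dk k : eqm N (D k) (q * (1 + q ^+ (2 * k).+2) * D k.+1).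
  have qL := eqmM (eqm_refl q) (Lsum_rec k).
  apply: eqm_trans (eqmB qL (Vsum_rec k)) _.
  by apply: eqm_eq; rewrite /D; ring.
have D0 m : exists g, eqm N (D 0%N) (q ^+ m * g * D m).
  elim: m => [|m [g IH]]; first by exists 1; rewrite !mul1r.
  exists (g * (1 + q ^+ (2 * m).+2)).
  apply: eqm_trans IH (eqm_trans (eqmM (eqm_refl _) (Dk m)) _).
  by apply: eqm_eq; rewrite [q ^+ m.+1]exprS; ring.
have [g Dg] := D0 N.
apply: eqm_trans Vsum_psi; apply: eqm_subr0; apply: eqm_trans Dg _.
by rewrite -mulrA; apply: eqm_mulX.
Qed.
End Telescope.

(* "allowed s i c a": the part of size i.+1 and color c may have multiplicity a
   when the smallest part is the blue one of size s.+1. *)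
Definition allowed (s i : nat) (c : color) (a : nat) : bool :=
  [&& (0 < a) && ~~ odd i.+1 ==> (c == blue), ~~ odd i.+1 ==> (a <= 1),
      odd i.+1 && (c == blue) ==> (a <= 1), (0 < a) ==> (s <= i)
    & (i == s) && (c == blue) ==> (0 < a)]%N.

(** * The signed count as a coefficient of products of one-part series *)

Definition sign_exp (i a : nat) : nat := if ~~ odd i.+1 then a else 0%N.

(** The range of [a] is that of the multiplicities in [mults n], so products of these sums expand
    exactly over [mults n]. *)
Definition local_gf (n s i : nat) (c : color) : {fps int} :=
  \sum_(a < n.+1 | allowed s i c a) (-1) ^+ sign_exp i a * q ^+ (a * i.+1).

Definition smallest_at n (s : 'I_n) (m : mults n) : bool :=
  (0 < m (s, blue))%N && [forall r, (0 < m r)%N ==> (s <= r.1)%N].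

(** Once the smallest part is fixed, each condition constrains one multiplicity at a time; this
    independence is what yields a product. *)
Lemma allowedP n (s : 'I_n) (m : mults n) :
  [forall p : 'I_n * color, allowed s p.1 p.2 (m p)] =
  [&& even_parts_blue m, even_parts_distinct m, blue_odd_parts_distinct m
    & smallest_at s m].
Proof.
apply/forallP/and4P => [H|].
  split; try by apply/forallP => p; have /and5P[] := H p.
  apply/andP; split; last by apply/forallP => p; have /and5P[] := H p.
  by have /and5P[_ _ _ _ /implyP] := H (s, blue); apply; rewrite !eqxx.
case=> /forallP H1 /forallP H2 /forallP H3 /andP[H4 /forallP H5] [i c].
apply/and5P; split; [exact: H1|exact: H2|exact: H3|exact: H5|].
apply/implyP => /= /andP[/eqP/val_inj -> /eqP ->]; exact: H4.
Qed.

(** Two smallest sizes bound each other, so at most one [s] contributes. Indices are sizes minus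
    one: an odd size has an even index. *)
Lemma smallest_part_sum n (m : mults n) (w : int) :
  (if smallest_part_odd_blue m then w else 0) =
  \sum_(s < n | ~~ odd s) (if smallest_at s m then w else 0).
Proof.
case: ifP => [/existsP[[s c] /= /and4P[m0 os /eqP cb /forallP le]]|].
  rewrite cb in m0.
  have Cs : smallest_at s m by apply/andP; split => //; apply/forallP.
  rewrite (bigD1 s) //= Cs big1 ?addr0 // => t /andP[ot ts].
  case: ifP => // /andP[mt /forallP let'].
  case/eqP: ts; apply/val_inj/eqP; rewrite eqn_leq.
  have /implyP := let' (s, blue); have /implyP := le (t, blue).
  by rewrite /part_size /= => /(_ mt) ? /(_ m0) ?; apply/andP.
move=> /negbT/existsPn H; rewrite big1 // => s os; case: ifP => // /andP[ms le].
by have /and4P[] := H (s, blue).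
Qed.

Lemma coef_signM (f : {fps int}) e n : ((-1) ^+ e * f) n = (-1) ^+ e * f n.
Proof.
elim: e f => [|e IH] f; first by rewrite !mul1r.
by rewrite !exprS !mulN1r !mulNr coef_fpsN IH.
Qed.

Lemma Tpsi_gf n : Tpsi n =
  (\sum_(s < n | ~~ odd s)
     \prod_(i < n) (local_gf n s i blue * local_gf n s i green)) n.
Proof.
rewrite /Tpsi.
transitivity (\sum_(m : mults n | [&& two_color_partition m, even_parts_blue m,
      even_parts_distinct m & blue_odd_parts_distinct m])
    \sum_(s < n | ~~ odd s)
      (if smallest_at s m then (-1) ^+ nb_even_parts m else 0 : int)).
  under [RHS]eq_bigr do rewrite -smallest_part_sum.
  by rewrite -big_mkcondr; apply: eq_bigl => m; rewrite -!andbA.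
rewrite exchange_big /= coef_fps_sum; apply: eq_bigr => s os.
have -> : \prod_(i < n) (local_gf n s i blue * local_gf n s i green) =
    \prod_(p : 'I_n * color) local_gf n s p.1 p.2.
  rewrite -(pair_bigA _ (fun (i : 'I_n) c => local_gf n s i c)) /=.
  by apply: eq_bigr => i _; rewrite big_bool.
pose Q (p : 'I_n * color) (a : 'I_n.+1) := allowed s p.1 p.2 a.
(* Distributivity gives one signed monomial per admissible [m]; its exponent is the number
   partitioned by [m]. *)
rewrite /local_gf (bigA_distr_big_dep Q).
rewrite coef_fps_sum -big_mkcondr /= [LHS]big_mkcond [RHS]big_mkcond /=.
apply: eq_bigr => m _.
have -> : (m \in family Q) =
   [forall p : 'I_n * color, allowed s p.1 p.2 (m p)] by apply/familyP/forallP.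
rewrite allowedP big_split -!expr_sum coef_signM coef_fpsXn.
have -> : (\sum_(p : 'I_n * color) sign_exp p.1 (m p) = nb_even_parts m)%N.
  by rewrite /nb_even_parts [RHS]big_mkcond.
rewrite /two_color_partition /part_size eq_sym.
by case: eqP; case: even_parts_blue; case: even_parts_distinct;
  case: blue_odd_parts_distinct; case: smallest_at; rewrite /= ?mulr1 ?mulr0.
Qed.

(** * Closed forms of the one-part series *)

Lemma big_ord_le1 n (P : pred nat) (F : nat -> {fps int}) : (0 < n)%N ->
  (forall a, ~~ P a.+2) ->
  \sum_(a < n.+1 | P a) F a =
  (if P 0%N then F 0%N else 0) + (if P 1%N then F 1%N else 0).
Proof.
case: n => // n _ P2; rewrite big_mkcond big_ord_recl big_ord_recl.
rewrite big1 => [|a _]; first by rewrite /= addr0.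
by rewrite (negbTE (P2 _)).
Qed.

Definition geo (n d : nat) : {fps int} := \sum_(a < n.+1) q ^+ (a * d).

Lemma local_gf_blue n s i : (i < n)%N -> ~~ odd s ->
  local_gf n s i blue =
  if (i < s)%N then 1 else if odd i then 1 - q ^+ i.+1 else
  if i == s then q ^+ i.+1 else 1 + q ^+ i.+1.
Proof.
move=> lt_in es; rewrite /local_gf (@big_ord_le1 n (allowed s i blue)
    (fun a => (-1) ^+ sign_exp i a * q ^+ (a * i.+1))); first last.
- by move=> a; rewrite /allowed /=; case: (odd i).
- by case: n lt_in.
rewrite /allowed /sign_exp !mul0n mul1n /= !negbK.
(* This excludes the contradictory case of an odd [i] equal to [s] in the final case analysis. *)
have: i == s -> ~~ odd i by move=> /eqP ->.
have [lt_is _|le_si] := ltnP i s.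
  by rewrite (ltn_eqF lt_is); case: (odd i); rewrite /= ?expr0 ?mulr1 addr0.
case: (odd i); case: (i == s) => H;
  rewrite /= ?add0r ?expr0 ?expr1 ?mul1r ?mulr1 ?mulN1r //.
by have := H isT.
Qed.

Lemma local_gf_green n s i : (i < n)%N -> ~~ odd s ->
  local_gf n s i green =
  if (i < s)%N then 1 else if odd i then 1 else geo n i.+1.
Proof.
move=> lt_in es; rewrite /local_gf.
have [c0|] := boolP ((i < s)%N || odd i).
  rewrite (@big_ord_le1 n (allowed s i green)
    (fun a => (-1) ^+ sign_exp i a * q ^+ (a * i.+1))); first last.
  - move=> a; rewrite /allowed (leqNgt s) oddS.
    by case: (i < s)%N c0; case: (odd i) => // _; rewrite ?andbF.
  - by case: n lt_in.
  rewrite /allowed /sign_exp !mul0n mul1n /= !negbK (leqNgt s) !andbF.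
  by case: (i < s)%N c0; case: (odd i) => //= _;
    rewrite ?expr0 ?mulr1 addr0.
rewrite negb_or => /andP[/negbTE is_ /negbTE oi]; rewrite is_ oi.
apply: eq_big => [a|a _]; last by rewrite /sign_exp /= oi mul1r.
by rewrite /allowed /= oi (leqNgt s) is_ /= !andbF implybT.
Qed.

(** * Completing the geometric sums and the products over sizes *)

Lemma geo_inv n d : eqm n.+1 (geo n d.+1) (1 - q ^+ d.+1)^-1.
Proof.
apply: (eqm_mulI (unit1BX d)); rewrite mulrV ?unit1BX //.
have -> : (1 - q ^+ d.+1) * geo n d.+1 = 1 - q ^+ (d.+1 * n.+1).
  rewrite exprM -[RHS]opprB subrX1 -mulNr opprB; congr (_ * _).
  by apply: eq_bigr => a _; rewrite mulnC exprM.
by apply: eqm1BX; nia.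
Qed.

(** Both colors together, with the green geometric sum completed; an odd [i], that is an even size,
    contributes blue parts only. *)
Definition lim_gf (s i : nat) : {fps int} :=
  if (i < s)%N then 1 else if odd i then 1 - q ^+ i.+1 else
  (if i == s then q ^+ i.+1 else 1 + q ^+ i.+1) / (1 - q ^+ i.+1).

Lemma local_gf_lim n s i : (i < n)%N -> ~~ odd s ->
  eqm n.+1 (local_gf n s i blue * local_gf n s i green) (lim_gf s i).
Proof.
move=> lt_in es; rewrite local_gf_blue // local_gf_green // /lim_gf.
case: ifP => _; first by rewrite mulr1.
case: ifP => _; first by rewrite mulr1.
exact: eqmM (eqm_refl _) (@geo_inv n i).
Qed.

(** This allows the range of sizes to be lengthened. For even [i], numerator and denominator of the
    quotient are both congruent to 1. *)
Lemma lim_gf_large N s i : (s < i)%N -> (N <= i.+1)%N -> eqm N (lim_gf s i) 1.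
Proof.
move=> si Ni; rewrite /lim_gf ltnNge (ltnW si) /= gtn_eqF //.
case: ifP => _; first exact: eqm1BX.
apply: (eqm_mulI (unit1BX i)); rewrite mulr1 mulrC mulrVK ?unit1BX //.
exact: eqm_trans (eqm1DX Ni) (eqm_sym (eqm1BX Ni)).
Qed.

(** It pairs the odd size [2j+1] with the even size [2j+2], as in the factors of [Eterm]. *)
Lemma big_nat_double (R : Type) (idx : R) (op : Monoid.law idx) N (F : nat -> R) :
  \big[op/idx]_(0 <= i < 2 * N) F i =
  \big[op/idx]_(0 <= j < N) op (F (2 * j)%N) (F (2 * j).+1).
Proof.
elim: N => [|N IH]; first by rewrite muln0 !big_geq.
rewrite (_ : (2 * N.+1 = (2 * N).+2)%N); last by lia.
by rewrite !big_nat_recr //= IH Monoid.mulmA.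
Qed.

Lemma prod_lim_gf N t : (t < N)%N ->
  eqm N (\prod_(0 <= i < 2 * N) lim_gf (2 * t) i) (q ^+ (2 * t).+1 * Eterm N 0 t).
Proof.
move=> tN; pose g j : {fps int} := 1 + q ^+ (2 * j).+1.
pose K j : {fps int} := (1 - q ^+ (2 * j).+2) / (1 - q ^+ (2 * j).+1).
have -> : \prod_(0 <= i < 2 * N) lim_gf (2 * t) i =
    \prod_(t <= j < N) K j * (q ^+ (2 * t).+1 * \prod_(t.+1 <= j < N) g j).
  pose F j := lim_gf (2 * t) (2 * j) * lim_gf (2 * t) (2 * j).+1.
  have -> : \prod_(0 <= i < 2 * N) lim_gf (2 * t) i =
      \prod_(0 <= j < t) F j * \prod_(t <= j < N) F j.
    by rewrite -big_cat_nat ?(ltnW tN) //; exact: big_nat_double.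
  have -> : \prod_(0 <= j < t) F j = 1.
    rewrite big_nat big1 // => j /andP[_ jt].
    by rewrite /F /lim_gf !ifT ?mulr1 //; lia.
  have -> : q ^+ (2 * t).+1 * \prod_(t.+1 <= j < N) g j =
      \prod_(t <= j < N) (if j == t then q ^+ (2 * t).+1 else g j).
    rewrite [RHS]big_ltn // eqxx; congr (_ * _).
    by apply: eq_big_nat => j /andP[tj _]; rewrite gtn_eqF.
  rewrite mul1r -[RHS]big_split; apply: eq_big_nat => j /andP[tj _].
  rewrite /F; have -> : lim_gf (2 * t) (2 * j).+1 = 1 - q ^+ (2 * j).+2.
    by rewrite /lim_gf ifF ?ifT //; lia.
  have -> : lim_gf (2 * t) (2 * j) =
      (if j == t then q ^+ (2 * t).+1 else g j) / (1 - q ^+ (2 * j).+1).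
    rewrite /lim_gf ltn_mul2l (ltnNge j) tj oddM /=.
    by congr (_ / _); rewrite eqn_mul2l /=; case: eqP => // ->.
  by rewrite /K [LHS]mulrC mulrA [RHS]mulrAC.
(* The exponents [2j+3] in [Eterm] reach one step further than those of [g] below [N]; the extra
   factor [g N] is congruent to 1. *)
have -> : Eterm N 0 t =
    \prod_(t <= j < N) K j * (\prod_(t.+1 <= j < N) g j * g N).
  rewrite Eterm_split -big_nat_recr // [X in _ = _ * X]big_add1; congr (_ * _).
  by apply: eq_bigr => j _; congr (1 + q ^+ _); lia.
rewrite [X in eqm _ _ X]mulrCA; apply: eqmM (eqm_refl _) _.
apply: eqmM (eqm_refl _) _.
rewrite -{1}[\prod_(_ <= _ < _) _]mulr1.
by apply: eqmM (eqm_refl _) (eqm_sym (eqm1DX _)); lia.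
Qed.

(** * Identification of the signed count with [Lsum], and conclusion *)

Lemma Tpsi_Lsum n : Tpsi n = (q * Lsum n.+1 0) n.
Proof.
rewrite Tpsi_gf; suff: eqm n.+1
  (\sum_(s < n | ~~ odd s)
     \prod_(i < n) (local_gf n s i blue * local_gf n s i green))
  (q * Lsum n.+1 0) by apply.
pose N := n.+1; pose Phi s := \prod_(0 <= i < 2 * N) lim_gf s i.
apply: (@eqm_trans _ _ (\sum_(0 <= s < n | ~~ odd s) Phi s)).
  rewrite big_mkord; apply: eqm_sum => s _ es.
  apply: (@eqm_trans _ _ (\prod_(i < n) lim_gf s i)).
    by apply: eqm_prod => i _ _; apply: local_gf_lim.
  rewrite /Phi (@big_cat_nat _ _ _ n); [|lia|lia].
  rewrite big_mkord -[X in eqm _ X]mulr1; apply: eqmM (eqm_refl _) (eqm_sym _).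
  apply: (@eqm_trans _ _ (\prod_(n <= i < 2 * N) 1));
    last by rewrite big1_eq.
  apply: eqm_prod => i; rewrite mem_index_iota => /andP[ni _] _.
  by apply: lim_gf_large; have := ltn_ord s; lia.
(* The added [Phi s] have [s >= n], and their factor at index [s] contains [q ^+ s.+1], which is 0
   modulo [q ^+ n.+1]. *)
apply: (@eqm_trans _ _ (\sum_(0 <= s < 2 * N | ~~ odd s) Phi s)).
  rewrite [X in eqm _ _ X](@big_cat_nat _ _ _ n); [|lia|lia].
  rewrite -[X in eqm _ X]addr0; apply: eqmD (eqm_refl _) (eqm_sym _).
  apply: (@eqm_trans _ _ (\sum_(n <= s < 2 * N | ~~ odd s) 0));
    last by rewrite big1_eq.
  apply: eqm_sum => s; rewrite mem_index_iota => /andP[ns sN] es.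
  have -> : Phi s =
      lim_gf s s * \prod_(0 <= i < 2 * N | i != s) lim_gf s i.
    by apply: bigD1_seq; [rewrite mem_index_iota sN|exact: iota_uniq].
  by rewrite {1}/lim_gf ltnn (negbTE es) eqxx -!mulrA; apply: eqm_mulX.
(* In each pair of indices only the even one, [s = 2t], survives. *)
rewrite big_mkcond big_nat_double /Lsum mulr_sumr; apply: eqm_sum => t.
rewrite mem_index_iota => /andP[_ tN] _.
rewrite /= oddM /= addr0.
by rewrite mulrA -exprS; apply: prod_lim_gf.
Qed.

Theorem theorem3 : \sum_(1 <= n <oo) Tpsi n *: fpsX ^+ n = psi.
Proof.
apply/fpsP => k; rewrite -(@Lsum_psi k.+1) // -Tpsi_Lsum.
have [M hM] := Tpsi_series_cvg k; rewrite -(hM (M + k.+1)%N) ?leq_addr //.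
(* The series starts at index 1, so degree 0 requires [Tpsi 0 = 0], which the factor [q] in front of
   [Lsum] provides. *)
rewrite coef_fps_sum; case: k {hM} => [|k].
  have -> : Tpsi 0 = 0 by rewrite Tpsi_Lsum coef_fpsM big_ord1 mul0r.
  rewrite big_nat big1 // => i /andP[i1 _].
  by rewrite coef_fpsZ coef_fpsXn ltn_eqF ?mulr0.
rewrite (bigD1_seq k.+1); [|by rewrite mem_index_iota; lia|exact: iota_uniq].
rewrite coef_fpsZ coef_fpsXn eqxx mulr1 big1 => [|i ik]; first exact: addr0.
by rewrite coef_fpsZ coef_fpsXn eq_sym (negbTE ik) mulr0.
Qed.
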